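(* Let $V$ be an infinite-dimensional complex inner product space with inner product $\langle \bullet | \bullet \rangle$ and full antidual $V'$. Then there is no inner product on $V'$ that is compatible with $\langle \bullet | \bullet \rangle$.
   Context: Inner products are antilinear in the first slot and linear in the second. No completeness of $V$ is assumed. The full antidual $V'$ is the complex vector space of all antilinear maps $V \to \mathbb{C}$, bounded or not. The canonical linear embedding $V \to V'$ sends $v \in V$ to $v' \in V'$ defined by $v'(z) = \langle z | v \rangle$ for all $z \in V$. The weak topology on $V'$ is that of pointwise convergence: a net $\zeta_\delta \to \zeta$ in $V'$ if and only if $\zeta_\delta(v) \to \zeta(v)$ for every $v \in V$. An inner product $[\bullet | \bullet]$ on $V'$ is called compatible with $\langle \bullet | \bullet \rangle$ if: (i) $[x' | y'] = \langle x | y \rangle$ for all $x, y \in V$; and (ii) it is weakly continuous in each slot, that is, if $\xi_\delta \to \xi$ and $\eta_\delta \to \eta$ weakly in $V'$ then $[\xi_\delta | \eta] \to [\xi | \eta]$ and $[\xi | \eta_\delta] \to [\xi | \eta]$. *)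

(* Defs.v *)
From HB Require Import structures.
From mathcomp Require Import all_boot all_order all_algebra sesquilinear.
From mathcomp Require Import all_classical all_reals all_analysis complex.

Set Implicit Arguments.
Unset Strict Implicit.
Unset Printing Implicit Defensive.

Import Order.TTheory GRing.Theory Num.Theory.
Import numFieldNormedType.Exports.

Local Open Scope classical_set_scope.
Local Open Scope ring_scope.

(* The usual topology of C: the generic instances on numeric fields are keyed
   on the structure and are not found for the concrete type R[i]. *)
HB.instance Definition _ (R : realType) := NormedModule.copy R[i] R[i]^o.

Definition finite_dimensional (K : fieldType) (V : lmodType K) : Prop :=
  exists (n : nat) (e : 'I_n -> V), forall v : V,
    exists a : 'I_n -> K, v = \sum_(i < n) a i *: e i.

(* An inner product on V is a form f : {dot V for Num.conj}.  Such a form is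
   linear in its first slot and antilinear in the second one, hence
   <x|y> := f y x, which is antilinear in x and linear in y. *)
Definition braket (R : realType) (V : lmodType R[i])
  (f : {dot V for (@Num.conj R[i])}) (x y : V) : R[i] := f y x.

Section Antidual.
Variables (R : realType) (V : lmodType R[i]).

(* All antilinear maps V -> C: f (a *: v) = a^* * f v and no continuity. *)
Definition antidual : Type := {linear V -> R[i] | (@Num.conj R[i]) \; *%R}.

Definition antidual_fun (xi : antidual) : V -> R[i] :=
  fun v => (xi : {linear V -> R[i] | (@Num.conj R[i]) \; *%R}) v.
Coercion antidual_fun : antidual >-> Funclass.

Lemma antidual_eqP (xi eta : antidual) : xi =1 eta -> xi = eta.
Proof.
case: xi eta => [x [[cx] [lx]]] [y [[cy] [ly]]] /funext /= E.
have {}E : x = y by exact: E.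
case: _ / E in cy ly *.
by rewrite (Prop_irrelevance cx cy) (Prop_irrelevance lx ly).
Qed.

HB.instance Definition _ := gen_eqMixin antidual.
HB.instance Definition _ := gen_choiceMixin antidual.

Lemma antidualD (xi : antidual) : {morph (xi : V -> R[i]) : u v / u + v}.
Proof. exact: raddfD. Qed.

Lemma antidualZ (xi : antidual) (a : R[i]) (v : V) :
  xi (a *: v) = Num.conj a * xi v.
Proof. exact: (linearZ_LR xi). Qed.

Definition antilinear (f : V -> R[i]) : Prop :=
  {morph f : u v / u + v} /\ forall a v, f (a *: v) = Num.conj a * f v.

Lemma antilinear_linear_for (f : V -> R[i]) :
  antilinear f -> linear_for ((@Num.conj R[i]) \; *%R) f.
Proof. by case=> fD fZ a u v; rewrite fD fZ. Qed.

Definition Antidual (f : V -> R[i]) (fP : antilinear f) : antidual :=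
  HB.pack_for {linear V -> R[i] | (@Num.conj R[i]) \; *%R} f
    (@GRing.isLinear.Build _ _ _ _ f (antilinear_linear_for fP)).

Fact antilinear0 : antilinear (fun=> 0).
Proof. by split=> [u v|a v]; rewrite ?addr0 ?mulr0. Qed.

Fact antilinearN (xi : antidual) : antilinear (fun v => - xi v).
Proof. by split=> [u v|a v]; rewrite ?antidualD ?antidualZ ?opprD ?mulrN. Qed.

Fact antilinearD (xi eta : antidual) : antilinear (fun v => xi v + eta v).
Proof.
by split=> [u v|a v]; rewrite ?antidualD ?antidualZ ?mulrDr// addrACA.
Qed.

Fact antilinearZ (b : R[i]) (xi : antidual) : antilinear (fun v => b * xi v).
Proof. by split=> [u v|a v]; rewrite ?antidualD ?antidualZ ?mulrDr// mulrCA. Qed.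

Let addA : associative (fun xi eta => Antidual (antilinearD xi eta)).
Proof. by move=> x y z; apply: antidual_eqP => v; exact: addrA. Qed.

Let addC : commutative (fun xi eta => Antidual (antilinearD xi eta)).
Proof. by move=> x y; apply: antidual_eqP => v; exact: addrC. Qed.

Let add0 : left_id (Antidual antilinear0)
  (fun xi eta => Antidual (antilinearD xi eta)).
Proof. by move=> x; apply: antidual_eqP => v; exact: add0r. Qed.

Let addN : left_inverse (Antidual antilinear0)
  (fun xi => Antidual (antilinearN xi))
  (fun xi eta => Antidual (antilinearD xi eta)).
Proof. by move=> x; apply: antidual_eqP => v; exact: addNr. Qed.

HB.instance Definition _ :=
  GRing.isZmodule.Build antidual addA addC add0 addN.

Let scaleA a b (xi : antidual) :
  Antidual (antilinearZ a (Antidual (antilinearZ b xi))) =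
  Antidual (antilinearZ (a * b) xi).
Proof. by apply: antidual_eqP => v; exact: mulrA. Qed.

Let scale1 : left_id 1 (fun a xi => Antidual (antilinearZ a xi)).
Proof. by move=> x; apply: antidual_eqP => v; exact: mul1r. Qed.

Let scaleDr : right_distributive (fun a xi => Antidual (antilinearZ a xi)) +%R.
Proof. by move=> a x y; apply: antidual_eqP => v; exact: mulrDr. Qed.

Let scaleDl (xi : antidual) :
  {morph (fun a => Antidual (antilinearZ a xi)) : a b / a + b}.
Proof. by move=> a b; apply: antidual_eqP => v; exact: mulrDl. Qed.

HB.instance Definition _ := GRing.Zmodule_isLmodule.Build R[i] antidual
  scaleA scale1 scaleDr scaleDl.

Lemma antidual_addE (xi eta : antidual) v : (xi + eta) v = xi v + eta v.
Proof. by []. Qed.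

Lemma antidual_scaleE (a : R[i]) (xi : antidual) v : (a *: xi) v = a * xi v.
Proof. by []. Qed.

(* The weak topology; antidual_cvgP below checks it against its description by
   pointwise convergence. *)
HB.instance Definition _ := Topological.copy antidual
  (initial_topology (antidual_fun : antidual -> {ptws V -> R[i]})).

Lemma antidual_cvgP (F : set_system antidual) (zeta : antidual) : Filter F ->
  F --> zeta <-> forall v : V, (fun xi : antidual => xi v) @ F --> zeta v.
Proof.
move=> FF; pose T : topologicalType := ({ptws V -> R[i]}).
pose e : antidual -> T := antidual_fun; split=> [cF v|cF].
  have ce : {for zeta, continuous e} by exact: (@initial_continuous _ T e).
  apply: (@cvg_comp _ _ _ e (fun g : T => g v) F (nbhs (e zeta))).
    exact: cvg_trans (cvg_app e cF) ce.
  exact: (@proj_continuous _ (fun=> R[i]) v (e zeta)).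
move=> A; rewrite nbhsE => -[_ [[B oB <-] Bz] sBA].
apply: filterS sBA _; change (nbhs (antidual_fun @ F) B).
have cT : antidual_fun @ F --> (antidual_fun zeta : T).
  apply/cvg_sup => v C; rewrite nbhsE => -[_ [[D oD <-] Dz] sDC].
  by apply: filterS sDC _; apply: (cF v); exact: open_nbhs_nbhs.
by apply: cT; exact: open_nbhs_nbhs.
Qed.

End Antidual.

Section Compatible.
Variables (R : realType) (V : lmodType R[i]).
Variable f : {dot V for (@Num.conj R[i])}.

Fact braket_antilinear (v : V) : antilinear (fun z => braket f z v).
Proof. by split=> [x y|a x]; rewrite /braket; [exact: raddfD|exact: linearZ]. Qed.

Definition canonical_embedding (v : V) : antidual V :=
  Antidual (braket_antilinear v).

Lemma canonical_embedding_linear : linear canonical_embedding.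
Proof.
move=> a x y; apply: antidual_eqP => z.
exact: (linearPl f z a x y).
Qed.

Record compatible (g : {dot (antidual V) for (@Num.conj R[i])}) : Prop := {
  compatible_isometry : forall x y : V,
    braket g (canonical_embedding x) (canonical_embedding y) = braket f x y;
  compatible_continuousl : forall eta : antidual V,
    continuous (fun xi : antidual V => braket g xi eta);
  compatible_continuousr : forall xi : antidual V,
    continuous (fun eta : antidual V => braket g xi eta)
}.

End Compatible.

(* Main.v *)
Require Import Defs.
From HB Require Import structures.
From mathcomp Require Import all_boot all_order all_algebra sesquilinear.
From mathcomp Require Import all_classical all_reals all_analysis complex.

Set Implicit Arguments.
Unset Strict Implicit.
Unset Printing Implicit Defensive.

Import Order.TTheory GRing.Theory Num.Theory.
Import numFieldNormedType.Exports.

Local Open Scope classical_set_scope.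
Local Open Scope ring_scope.

(** Suppose that [.|.] is an inner product on V' compatible with <.|.>.
    A weakly continuous linear functional on V' depends only on the values of its
    argument at finitely many vectors ([continuous_finite_support]). This is used
    twice for the functional [zeta|.].

    For zeta = y', it takes the value <y|x> = x'(y) at x', and V is weakly dense
    in V' ([canonical_embedding_dense]), so [y'|eta] = eta(y) for every eta.
    For zeta = eta, it follows that eta(x), the conjugate of [eta|x'], vanishes as
    soon as x is orthogonal to a certain finite set of vectors. Then eta is
    <.|z> for some z in V ([finite_support_representable]).

    So compatibility makes the canonical embedding onto. If V has infinite
    dimension this is impossible ([nonrepresentable_antidual]): V contains an
    orthonormal sequence, Zorn's lemma gives an antilinear functional equal to 1
    on all its terms, and Bessel's inequality forbids such a functional to be of
    the form <.|z>. *)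

(** * Linear functionals vanishing on a subspace *)

Section Hyperplane.
Variables (K : fieldType) (V : lmodType K).

Definition subspace (W : set V) : Prop :=
  W 0 /\ forall a x y, W x -> W y -> W (a *: x + y).

Lemma subspaceD W x y : subspace W -> W x -> W y -> W (x + y).
Proof. by move=> [_ WL] Wx Wy; rewrite -[x]scale1r; exact: WL. Qed.

Lemma subspaceZ W a x : subspace W -> W x -> W (a *: x).
Proof. by move=> [W0 WL] Wx; rewrite -[_ *: _]addr0; exact: WL. Qed.

Lemma subspaceB W x y : subspace W -> W x -> W y -> W (x - y).
Proof.
by move=> WS Wx Wy; rewrite -scaleN1r; apply: subspaceD => //; apply: subspaceZ.
Qed.

(** Zorn's lemma gives a maximal subspace among those that contain W and avoid
    t; adjoining any further vector to it captures t, so it has codimension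
    one. *)
Lemma hyperplane_ex (W : set V) (t : V) : subspace W -> ~ W t ->
  exists H : set V, [/\ subspace H, W `<=` H, ~ H t &
    forall x, exists a, H (x - a *: t)].
Proof.
move=> Wsub Wt.
(* A ranges over arbitrary sets and W is added afterwards, so that the union of
   the empty chain satisfies P *)
pose P (A : set V) := subspace (A `|` W) /\ ~ (A `|` W) t.
have [|A [[Asub At] Amax]] := @Zorn_bigcup V P.
  move=> F FP Ftot; split; last first.
    by move=> [[B FB Bt]|//]; have [_ []] := FP _ FB; left.
  split; first by right; exact: Wsub.1.
  have PW : P set0 by split; rewrite set0U.
  (* the empty set stands in when neither x nor y is in a member of the chain *)
  have key x y : (\bigcup_(B in F) B `|` W) x -> (\bigcup_(B in F) B `|` W) y ->
      exists B, [/\ P B, B `<=` \bigcup_(B in F) B, (B `|` W) x & (B `|` W) y].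
    move=> [[B FB Bx]|Wx] [[C FC Cy]|Wy].
    - have [BC|CB] := Ftot _ _ FB FC.
        exists C; split; [exact: FP|by move=> z Cz; exists C|by left; exact: BC|by left].
      exists B; split; [exact: FP|by move=> z Cz; exists B|by left|by left; exact: CB].
    - exists B; split; [exact: FP|by move=> z Cz; exists B|by left|by right].
    - exists C; split; [exact: FP|by move=> z Cz; exists C|by right|by left].
    - by exists set0; split => //; right.
  move=> a x y /key xU /xU[B [[[_ BL] _] BU Bx By]].
  by case: (BL a _ _ Bx By) => [/BU|]; [left|right].
exists (A `|` W); split=> // x; have [Hx|Hx] := pselect ((A `|` W) x).
  by exists 0; rewrite scale0r subr0.
pose B : set V := [set y | exists b h, (A `|` W) h /\ y = h + b *: x].
have [[b [h [Hh tE]]]|Bt] := pselect (B t).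
  have b0 : b != 0 by apply: contra_notN At => /eqP b0; rewrite tE b0 scale0r addr0.
  exists b^-1; rewrite tE scalerDr scalerA mulVf// scale1r opprD addrCA subrr addr0.
  by rewrite -scalerN -scaleN1r scalerA; exact: subspaceZ.
exfalso; apply: Hx.
(* otherwise B, the span of x and the maximal subspace, avoids t *)
have AB : A `|` W `<=` B by move=> y Hy; exists 0, y; rewrite scale0r addr0.
have BW : B `|` W = B by apply/setUidPl => y Wy; apply: AB; right.
have BP : P B.
  rewrite /P BW; split=> //; split; first by apply: AB; exact: Asub.1.
  move=> c y z [b [h [Hh ->]]] [b' [h' [Hh' ->]]].
  exists (c * b + b'), (c *: h + h'); split; first exact: Asub.2.
  by rewrite scalerDl scalerDr !scalerA addrACA.
have Bx : B x by exists 1, 0; rewrite add0r scale1r; split=> //; exact: Asub.1.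
have [->|/eqP nAB] := eqVneq A B; first by left.
exfalso; apply: (Amax B) => //; split; first by move=> y Ay; apply: AB; left.
by move=> BA; apply: nAB; apply/seteqP; split=> // y Ay; apply: AB; left.
Qed.

(** The value at x is the unique a such that x - a *: t lies in the
    hyperplane. *)
Lemma separating_functional (W : set V) (t : V) : subspace W -> ~ W t ->
  exists phi : V -> K, [/\ (forall a x y, phi (a *: x + y) = a * phi x + phi y),
    phi t = 1 & forall x, W x -> phi x = 0].
Proof.
move=> Wsub Wt; have [H [Hsub WH Ht Hx]] := hyperplane_ex Wsub Wt.
have [phi phiP] := choice Hx.
have phi_uniq x a : H (x - a *: t) -> phi x = a.
  move=> Ha; apply/eqP; rewrite -subr_eq0; apply: contra_notT Ht => ab.
  rewrite -[t]scale1r -(mulVf ab) -scalerA; apply: subspaceZ => //.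
  have -> : (phi x - a) *: t = (x - a *: t) - (x - phi x *: t).
    by rewrite opprB [RHS]addrC addrA subrK scalerBl.
  exact: subspaceB.
exists phi; split.
- move=> a x y; apply: phi_uniq.
  have -> : a *: x + y - (a * phi x + phi y) *: t =
            a *: (x - phi x *: t) + (y - phi y *: t).
    by rewrite scalerDl scalerBr scalerA opprD addrACA.
  exact: Hsub.2.
- by apply: phi_uniq; rewrite scale1r subrr; exact: Hsub.1.
- by move=> x Wx; apply: phi_uniq; rewrite scale0r subr0; exact: WH.
Qed.

End Hyperplane.

(** * Inner products in Dirac notation *)

Section InnerProduct.
Variables (R : realType) (V : lmodType R[i]).
Variable f : {dot V for (@Num.conj R[i])}.
Local Notation "<< x | y >>" := (braket f x y).

Lemma braketC x y : <<x | y>> = Num.conj <<y | x>>.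
Proof. by rewrite /braket (hermC f) expr0 mul1r. Qed.

Lemma braketDr x y z : <<x | y + z>> = <<x | y>> + <<x | z>>.
Proof. exact: linearDl. Qed.

Lemma braketBr x y z : <<x | y - z>> = <<x | y>> - <<x | z>>.
Proof. exact: linearBl. Qed.

Lemma braketZr a x y : <<x | a *: y>> = a * <<x | y>>.
Proof. exact: (linearZl_LR f x a y). Qed.

Lemma braket_sumr I (r : seq I) x (F : I -> V) :
  <<x | \sum_(i <- r) F i>> = \sum_(i <- r) <<x | F i>>.
Proof. exact: linear_sumlz. Qed.

Lemma braketDl x y z : <<x + y | z>> = <<x | z>> + <<y | z>>.
Proof. exact: raddfD. Qed.

Lemma braketBl x y z : <<x - y | z>> = <<x | z>> - <<y | z>>.
Proof. exact: raddfB. Qed.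

Lemma braketZl a x y : <<a *: x | y>> = Num.conj a * <<x | y>>.
Proof. exact: (linearZr_LR f y a x). Qed.

Lemma braket_suml I (r : seq I) x (F : I -> V) :
  <<\sum_(i <- r) F i | x>> = \sum_(i <- r) <<F i | x>>.
Proof. exact: raddf_sum. Qed.

Lemma braket0r x : <<x | 0>> = 0.
Proof. exact: linear0l. Qed.

Lemma braket_gt0 x : x != 0 -> 0 < <<x | x>>.
Proof. exact: (@neq0_dnorm_gt0 _ _ _ f). Qed.

Lemma braket_ge0 x : 0 <= <<x | x>>.
Proof. by have [->|/braket_gt0/ltW//] := eqVneq x 0; rewrite braket0r. Qed.

Lemma normalize_ex x : x != 0 -> exists a, <<a *: x | a *: x>> = 1.
Proof.
move=> /braket_gt0 x0; pose c := sqrtC <<x | x>>.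
have c0 : 0 < c by rewrite sqrtC_gt0.
exists c^-1; rewrite braketZl braketZr geC0_conj ?invr_ge0 ?ltW//.
by rewrite mulrA -expr2 exprVn sqrtCK mulVf// gt_eqF.
Qed.

(** * Projections onto finite-dimensional subspaces *)

Definition proj (e : seq V) (x : V) : V := \sum_(w <- e) <<w | x>> *: w.

(** Every orthonormal list is a frame. Asking only that the members be fixed by
    proj e is already enough for proj e to be the orthogonal projection onto
    their span, and is the condition that the arguments below use. *)
Definition frame (e : seq V) : Prop := forall w, w \in e -> proj e w = w.

Lemma proj_adjoint e x y : <<proj e x | y>> = <<x | proj e y>>.
Proof.
rewrite braket_suml braket_sumr; apply: eq_bigr => w _.
by rewrite braketZl braketZr -braketC mulrC.
Qed.

Lemma projD e x y : proj e (x + y) = proj e x + proj e y.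
Proof. by rewrite -big_split; apply: eq_bigr => w _; rewrite braketDr scalerDl. Qed.

Lemma projZ e a x : proj e (a *: x) = a *: proj e x.
Proof. by rewrite scaler_sumr; apply: eq_bigr => w _; rewrite braketZr scalerA. Qed.

Lemma proj_sum e (r : seq V) (c : V -> R[i]) :
  proj e (\sum_(w <- r) c w *: w) = \sum_(w <- r) c w *: proj e w.
Proof.
under [RHS]eq_bigr do rewrite scaler_sumr.
rewrite exchange_big; apply: eq_bigr => u _.
rewrite braket_sumr scaler_suml; apply: eq_bigr => w _.
by rewrite braketZr scalerA.
Qed.

Lemma proj_idem e x : frame e -> proj e (proj e x) = proj e x.
Proof.
by move=> fe; rewrite proj_sum; apply: eq_big_seq => w /fe ->.
Qed.

Lemma residual_orthogonal e x y :
  proj e y = y -> <<x - proj e x | y>> = 0.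
Proof. by move=> ey; rewrite braketBl proj_adjoint ey subrr. Qed.

Lemma residual_unit_ex e x : proj e x != x ->
  exists a, let u := a *: (x - proj e x) in
    <<u | u>> = 1 /\ forall y, proj e y = y -> <<u | y>> = 0.
Proof.
move=> ex; have [|a a1] := @normalize_ex (x - proj e x).
  by rewrite subr_eq0 eq_sym.
by exists a; split=> // y ey; rewrite braketZl residual_orthogonal ?mulr0.
Qed.

Lemma proj_cons_fixed e u y : <<u | y>> = 0 -> proj (u :: e) y = proj e y.
Proof. by move=> uy; rewrite /proj big_cons uy scale0r add0r. Qed.

Lemma frame_cons e u : frame e -> <<u | u>> = 1 ->
  (forall y, proj e y = y -> <<u | y>> = 0) -> frame (u :: e).
Proof.
move=> fe uu ue w; rewrite inE => /orP[/eqP ->|we].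
  rewrite /proj big_cons uu scale1r big1_seq ?addr0// => v /andP[_ ve].
  by rewrite braketC ue ?fe// conjC0 scale0r.
by rewrite proj_cons_fixed ?fe ?ue// fe.
Qed.

(** One step of the Gram-Schmidt process: the new vector is the normalized
    residual of x, if it is nonzero. *)
Lemma frame_extend e x : frame e -> exists e', [/\ frame e', proj e' x = x &
  forall y, proj e y = y -> proj e' y = y].
Proof.
move=> fe; have [ex|ex] := eqVneq (proj e x) x; first by exists e; split.
have [a] := residual_unit_ex ex; set u := a *: _ => -[uu ue].
have fu := frame_cons fe uu ue.
have keep y : proj e y = y -> proj (u :: e) y = y.
  by move=> ey; rewrite proj_cons_fixed ?ue.
exists (u :: e); split=> //.
have a0 : a != 0.
  by apply: contraTneq (oner_neq0 R[i]) => a0; rewrite -uu /u a0 scale0r braket0r eqxx.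
have -> : x = a^-1 *: u + proj e x by rewrite scalerA mulVf// scale1r subrK.
by rewrite projD projZ fu ?mem_head// keep ?proj_idem.
Qed.

Lemma frame_fixing (s : seq V) : exists e, frame e /\ forall v, v \in s -> proj e v = v.
Proof.
elim: s => [|x s [e [fe es]]]; first by exists [::].
have [e' [fe' e'x e'e]] := frame_extend x fe.
exists e'; split=> // v; rewrite inE => /orP[/eqP->//|/es]; exact: e'e.
Qed.

(** * Density and representability in the antidual *)

(** Every antilinear functional, bounded or not, is represented by a vector on a
    finite-dimensional subspace. *)
Lemma antidual_proj (eta : antidual V) e x :
  eta (proj e x) = <<x | \sum_(w <- e) eta w *: w>>.
Proof.
rewrite braket_sumr.
rewrite /proj; elim/big_rec2: _ => [|w y1 y2 _ IH].
  exact: (@raddf0 _ _ (eta : {linear V -> R[i] | (@Num.conj R[i]) \; *%R})).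
by rewrite antidualD antidualZ IH braketZr -braketC mulrC.
Qed.

(** This is weak density of V in its antidual, in the strong form that finitely
    many values are attained exactly. *)
Lemma canonical_embedding_dense (eta : antidual V) (s : seq V) :
  exists x, forall v, v \in s -> canonical_embedding f x v = eta v.
Proof.
have [e [_ es]] := frame_fixing s.
exists (\sum_(w <- e) eta w *: w) => v vs.
by rewrite -[in RHS](es _ vs) antidual_proj.
Qed.

(** The hypothesis allows x to be replaced by its projection onto a
    finite-dimensional subspace that contains s, where eta is represented. *)
Lemma finite_support_representable (eta : antidual V) (s : seq V) :
  (forall x, (forall v, v \in s -> <<x | v>> = 0) -> eta x = 0) ->
  exists z, forall x, eta x = <<x | z>>.
Proof.
move=> etas; have [e [_ es]] := frame_fixing s.
exists (\sum_(w <- e) eta w *: w) => x; rewrite -antidual_proj.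
rewrite -[in LHS](subrK (proj e x) x) antidualD etas ?add0r// => v vs.
exact: residual_orthogonal (es _ vs).
Qed.

(** * A non-representable antilinear functional *)

(** A list e such that proj e fixes every vector would span V; hence each frame
    leaves a nonzero residual, which is normalized and added to it. *)
Lemma orthonormal_sequence : ~ finite_dimensional V ->
  exists u : nat -> V, forall m n, <<u m | u n>> = (m == n)%:R.
Proof.
move=> Vinf.
have step e : exists u,
    <<u | u>> = 1 /\ forall y, proj e y = y -> <<u | y>> = 0.
  suff [x ex] : exists x, proj e x != x.
    by have [a ?] := residual_unit_ex ex; exists (a *: (x - proj e x)).
  apply: contra_notP Vinf => all_fixed.
  exists (size e), (fun i => nth 0 e i) => v.
  exists (fun i => <<nth 0 e i | v>>).
  have [vE|/eqP ev] := eqVneq (proj e v) v; last by case: all_fixed; exists v; apply/eqP.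
  by rewrite -{1}vE /proj (big_nth 0) big_mkord.
have [h hP] := choice step.
pose E := fix E n := if n is n'.+1 then h (E n') :: E n' else [::].
have fE n : frame (E n).
  by elim: n => // n fE; have [? ?] := hP (E n); exact: frame_cons.
pose u n := h (E n).
have uE m n : (m < n)%N -> u m \in E n.
  elim: n => // n IH; rewrite ltnS leq_eqVlt inE => /orP[/eqP->|/IH ->].
    by rewrite eqxx.
  by rewrite orbT.
have lt0 m n : (m < n)%N -> <<u n | u m>> = 0.
  by move=> mn; apply: (hP (E n)).2; apply: fE; exact: uE.
exists u => m n; have [mn|nm|->] := ltngtP m n; last exact: (hP (E n)).1.
  by rewrite braketC lt0// conjC0.
by rewrite lt0.
Qed.

(** By Bessel's inequality N * |c|^2 <= <z|z> for every N. *)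
Lemma orthonormal_constant_coefficient (u : nat -> V) (c : R[i]) (z : V) :
  (forall m n, <<u m | u n>> = (m == n)%:R) -> (forall n, <<u n | z>> = c) ->
  c = 0.
Proof.
move=> uon uz.
have bessel N : (c * Num.conj c) *+ N <= <<z | z>>.
  pose p := \sum_(n < N) c *: u n.
  have up (n : 'I_N) : <<u n | p>> = c.
    rewrite braket_sumr (bigD1 n)//= braketZr uon eqxx mulr1 big1 ?addr0// => m mn.
    by rewrite braketZr uon -[_ == _]/(n == m) eq_sym (negbTE mn) mulr0.
  have pp : <<p | p>> = (c * Num.conj c) *+ N.
    rewrite {1}/p braket_suml.
    under eq_bigr do rewrite braketZl up mulrC.
    by rewrite sumr_const card_ord.
  have pz : <<p | z - p>> = 0.
    rewrite {1}/p braket_suml big1// => n _.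
    by rewrite braketZl braketBr uz up subrr mulr0.
  have zE : z = p + (z - p) by rewrite addrC subrK.
  rewrite [in leRHS]zE braketDl !(braketDr _ p) pz [<<z - p | p>>]braketC pz.
  by rewrite conjC0 addr0 add0r pp lerDl braket_ge0.
apply/eqP; apply: contraT => c0.
have cc : 0 < c * Num.conj c by rewrite -normCK exprn_gt0// normr_gt0.
pose r := complex.Re <<z | z>> / complex.Re (c * Num.conj c).
have rc : 0 < complex.Re (c * Num.conj c).
  by move: cc; rewrite ltcE => /andP[].
have := bessel (Num.truncn r).+1; rewrite lecE => /andP[_].
rewrite raddfMn/= -mulr_natr mulrC -ler_pdivlMr//.
by rewrite leNgt truncnS_gt.
Qed.

(** A functional with value 1 at every u n is not represented, by Bessel's
    inequality. To get one it suffices to separate u 0 from a subspace that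
    contains all the differences u n - u 0; the subspace W used here consists of
    the vectors whose coefficients have partial sums that vanish eventually. *)
Lemma nonrepresentable_antidual : ~ finite_dimensional V ->
  exists eta : antidual V, ~ exists z, forall x, eta x = <<x | z>>.
Proof.
move=> /orthonormal_sequence[u uon].
pose W := [set x : V | exists N, forall M, (N <= M)%N ->
  \sum_(n < M) <<u n | x>> = 0].
have Wsub : subspace W.
  split; first by exists 0%N => M _; rewrite big1// => n _; exact: braket0r.
  move=> a x y [N xN] [N' yN']; exists (maxn N N') => M; rewrite geq_max => /andP[NM N'M].
  under eq_bigr do rewrite braketDr braketZr.
  by rewrite big_split/= -mulr_sumr xN// yN'// mulr0 addr0.
have sumu m M : (m < M)%N -> \sum_(n < M) <<u n | u m>> = 1.
  move=> mM; rewrite (bigD1 (Ordinal mM))//= uon eqxx big1 ?addr0// => n nm.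
  by rewrite uon -[_ == _]/(n == Ordinal mM) (negbTE nm).
have Wu0 : ~ W (u 0%N).
  move=> [N /(_ N.+1 (leqnSn N))]; rewrite sumu// => /eqP.
  by rewrite oner_eq0.
have [phi [phiL phi0 phiW]] := separating_functional Wsub Wu0.
have phi1 n : phi (u n) = 1.
  have Wd : W (u n - u 0%N).
    exists n.+1 => M nM; under eq_bigr do rewrite braketBr.
    by rewrite sumrB !sumu ?subrr//; exact: leq_ltn_trans nM.
  by rewrite -[u n](subrK (u 0%N)) -[_ - _]scale1r phiL phiW// phi0 mulr0 add0r.
have phi_00 : phi 0 = 0 by apply: phiW; exact: Wsub.1.
have alphi : antilinear (fun x => Num.conj (phi x)).
  split=> [x y|a x].
    by rewrite -[x in LHS]scale1r phiL mul1r rmorphD.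
  by rewrite -[_ *: _]addr0 phiL phi_00 addr0 rmorphM.
exists (Antidual alphi) => -[z zP].
have uz n : <<u n | z>> = 1.
  by rewrite -zP /antidual_fun/= phi1 conjC1.
have /eqP := orthonormal_constant_coefficient uon uz.
by rewrite oner_eq0.
Qed.

End InnerProduct.

(** * Weakly continuous functionals on the antidual *)

(** A weak neighbourhood of 0 on which L is bounded by 1 contains all functionals
    vanishing on some finite s; these form a subspace, and a homogeneous map
    bounded on a subspace is zero on it. *)
Lemma continuous_finite_support (R : realType) (V : lmodType R[i])
    (L : antidual V -> R[i]) :
  (forall a xi, L (a *: xi) = a * L xi) -> continuous L ->
  exists s : seq V, forall xi : antidual V,
    (forall v, v \in s -> xi v = 0) -> L xi = 0.
Proof.
move=> LZ Lc.
(* this filter is finer than the weak neighbourhoods of 0, which leave room for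
   a small error at the points of s *)
pose F : set_system (antidual V) := [set A | exists s : seq V,
  forall xi : antidual V, (forall v, v \in s -> xi v = 0) -> A xi].
have FF : Filter F.
  split; first by exists [::].
  - move=> A B [s sA] [s' sB]; exists (s ++ s') => xi xis; split.
      by apply: sA => v vs; apply: xis; rewrite mem_cat vs.
    by apply: sB => v vs; apply: xis; rewrite mem_cat vs orbT.
  - by move=> A B AB [s sA]; exists s => xi /sA /AB.
have F0 : F --> (0 : antidual V).
  apply/antidual_cvgP => v A A0; exists [:: v] => xi /(_ v).
  rewrite mem_head => /(_ isT) xiv.
  by rewrite /= xiv; exact: nbhs_singleton A0.
have L0 : L 0 = 0 by rewrite -(scale0r (0 : antidual V)) LZ mul0r.
have : \forall y \near L 0, `|L 0 - y| < 1.
  by apply: (@cvgr_dist_lt _ _ _ (nbhs (L 0)) _ id) => //; exact: cvg_id.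
move=> /(Lc 0) /F0 [s sL]; exists s => xi xis.
apply/eqP; apply: contraT => Lxi.
have := sL ((L xi)^-1 *: xi); rewrite /= LZ mulVf// L0 sub0r normrN normr1 ltxx.
by apply=> v vs; rewrite /= xis// mulr0.
Qed.

Theorem mainTheorem1 (R : realType) (V : lmodType R[i])
    (f : {dot V for (@Num.conj R[i])}) (Vinf : ~ finite_dimensional V) :
  ~ exists g : {dot (antidual V) for (@Num.conj R[i])}, compatible f g.
Proof.
move=> [g [gf _ gc]].
have support (zeta : antidual V) : exists s : seq V, forall xi : antidual V,
    (forall v, v \in s -> xi v = 0) -> braket g zeta xi = 0.
  apply: continuous_finite_support (gc zeta) => a xi; exact: braketZr.
(* density determines g as soon as one argument comes from V *)
have gE y (eta : antidual V) : braket g (canonical_embedding f y) eta = eta y.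
  have [s sP] := support (canonical_embedding f y).
  have [x xP] := canonical_embedding_dense f eta (y :: s).
  have : braket g (canonical_embedding f y) (eta - canonical_embedding f x) = 0.
    apply: sP => v vs; rewrite -[LHS]/(eta v - canonical_embedding f x v).
    by rewrite xP ?subrr// inE vs orbT.
  by rewrite braketBr gf => /subr0_eq ->; rewrite -xP ?mem_head.
have [eta] := nonrepresentable_antidual f Vinf; apply.
have [s sP] := support eta.
apply: (@finite_support_representable _ _ _ _ s) => x xs.
rewrite -gE braketC sP ?conjC0// => v vs.
by rewrite [LHS]braketC xs// conjC0.
Qed.
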